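(* Let $\Gamma$ be a finite simplicial graph with $\Gamma\in\mathcal T$. Then the right-angled Coxeter group $W_\Gamma$ is strongly algebraically thick.
   Context: Graphs are finite simplicial graphs; ''subgraph'' always means full induced subgraph. For a graph $\Gamma$ with vertex set $\mathcal S$, the right-angled Coxeter group is $W_\Gamma=\langle \mathcal S\mid s^2\ (s\in\mathcal S),\ (st)^2\ (\{s,t\}\text{ an edge})\rangle$. Given a graph $\Gamma$ and a subgraph $\Lambda$, ''coning off $\Lambda$'' means adding one new vertex joined by edges to every vertex of $\Lambda$. Given graphs $\Gamma_1,\Gamma_2$ each containing (as induced subgraph) a copy of a graph $\Gamma_0$, the union along $\Gamma_0$ is the disjoint union with the two copies of $\Gamma_0$ identified; a generalized union is any graph obtained from this union by adding some edges joining vertices of $\Gamma_1\setminus\Gamma_0$ to vertices of $\Gamma_2\setminus\Gamma_0$. The class $\mathcal T$ of thick graphs is the smallest class of graphs such that: (1) $K_{2,2}$ (the 4-cycle) is in $\mathcal T$; (2) if $\Gamma\in\mathcal T$ and $\Lambda\subset\Gamma$ is an induced subgraph which is not a clique, then the graph obtained by coning off $\Lambda$ is in $\mathcal T$; (3) if $\Gamma_1,\Gamma_2\in\mathcal T$ both contain an induced subgraph isomorphic to a graph $\Gamma_0$ which is not a clique, then every generalized union of $\Gamma_1,\Gamma_2$ along $\Gamma_0$ is in $\mathcal T$. A finitely generated group is wide if no asymptotic cone has a cut point (equivalently, it has linear divergence); it is then strongly algebraically thick of order $0$. For $n\ge1$, $G$ is strongly algebraically thick of order at most $n$ if there is a finite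 collection $\mathcal H$ of subgroups with: (i) each $H\in\mathcal H$ strongly algebraically thick of order at most $n-1$; (ii) $\langle\bigcup_{H\in\mathcal H}H\rangle$ has finite index in $G$; (iii) there is $C\ge0$ such that for all $H,H'\in\mathcal H$ there is a sequence $H=H_1,\dots,H_k=H'$ in $\mathcal H$ with each $H_i\cap H_{i+1}$ infinite and with path-connected $C$-neighborhood (in a fixed word metric on $G$); (iv) for every $H\in\mathcal H$, any two points of $H$ are joined by a $(C,C)$-quasigeodesic lying in the $C$-neighborhood of $H$. $G$ is strongly algebraically thick if it is so of order at most $n$ for some $n$. *)

(* Defs.v *)
From Stdlib Require Import Reals Relations ClassicalEpsilon.
From HB Require Import structures.
From mathcomp Require Import all_boot.

(* mathcomp rebinds %R to ring_scope; use %Re for Stdlib reals *)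
Delimit Scope R_scope with Re.

Set Implicit Arguments.
Unset Strict Implicit.
Unset Printing Implicit Defensive.

Record graph := Graph {
  gV : finType;
  gadj : rel gV;
  gadj_sym : symmetric gadj;
  gadj_irr : irreflexive gadj }.

Definition induced_iso (G H : graph) (A : {set gV G}) : Prop :=
  exists f : gV H -> gV G,
    injective f /\ (forall x, f x \in A) /\
    (forall a, a \in A -> exists x, f x = a) /\
    (forall x y, @gadj H x y = @gadj G (f x) (f y)).

Arguments induced_iso : clear implicits.

Definition not_clique (G : graph) (A : {set gV G}) : Prop :=
  exists x y, [/\ x \in A, y \in A, x != y & ~~ @gadj G x y].

Definition c4_adj : rel 'I_4 := fun i j => odd (i + j).
Lemma c4_sym : symmetric c4_adj.
Proof. by move=> i j; rewrite /c4_adj addnC. Qed.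
Lemma c4_irr : irreflexive c4_adj.
Proof. by move=> i; rewrite /c4_adj addnn odd_double. Qed.
Definition K22 : graph := Graph c4_sym c4_irr.

(* The class T of thick graphs (closed under isomorphism). *)
Inductive thick_graph : graph -> Prop :=
| thick_K22 (G : graph) :
    induced_iso G K22 [set: gV G] -> thick_graph G
| thick_cone (Gm G : graph) (v : gV G) :
    (* G is Gm with Lambda coned off by the new vertex v *)
    thick_graph Gm ->
    induced_iso G Gm [set~ v] ->
    not_clique [set x | (x != v) && @gadj G v x] ->
    thick_graph G
| thick_union (G1 G2 G : graph) (V1 V2 : {set gV G}) :
    (* G is a generalized union of G1 and G2 along G[V1 :&: V2] *)
    thick_graph G1 -> thick_graph G2 ->
    V1 :|: V2 = [set: gV G] ->
    induced_iso G G1 V1 -> induced_iso G G2 V2 ->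
    not_clique (V1 :&: V2) ->
    thick_graph G.

Section RACG.
Variable G : graph.

Definition word := seq (gV G).

Inductive racg_step : word -> word -> Prop :=
| step_cancel u v s : racg_step (u ++ [:: s; s] ++ v) (u ++ v)
| step_comm u v s t : @gadj G s t -> racg_step (u ++ [:: s; t] ++ v) (u ++ [:: t; s] ++ v).

(* equality in W_G (product = concatenation, identity = [::], inverse = rev) *)
Definition weq : word -> word -> Prop := clos_refl_sym_trans word racg_step.

Definition subgroup (H : word -> Prop) : Prop :=
  [/\ H [::], (forall x y, H x -> H y -> H (x ++ y)),
      (forall x, H x -> H (rev x)) & (forall x y, weq x y -> H x -> H y)].

Definition subset_of (H P : word -> Prop) : Prop := forall x, H x -> P x.

Definition generates (P : word -> Prop) (S : seq word) : Prop :=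
  (forall s, s \in S -> P s) /\
  forall x, P x -> exists l : seq word,
      all (fun u => u \in S ++ map rev S) l /\ weq x (flatten l).

Definition dle (S : seq word) (x y : word) (k : nat) : Prop :=
  exists l : seq word, (size l <= k) /\
    all (fun u => u \in S ++ map rev S) l /\ weq (rev x ++ y) (flatten l).

Definition wdist (S : seq word) (x y : word) : nat :=
  epsilon (inhabits 0) (fun k => dle S x y k /\ forall j, dle S x y j -> k <= j).

Definition nonprincipal_ultrafilter (w : (nat -> Prop) -> Prop) : Prop :=
  w (fun _ => True) /\ ~ w (fun _ => False) /\
  (forall A B : nat -> Prop, w A -> (forall n, A n -> B n) -> w B) /\
  (forall A B : nat -> Prop, w A -> w B -> w (fun n => A n /\ B n)) /\
  (forall A : nat -> Prop, w A \/ w (fun n => ~ A n)) /\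
  (forall m, w (fun n => m < n)).

Definition ulim (w : (nat -> Prop) -> Prop) (a : nat -> R) (L : R) : Prop :=
  forall eps, (0 < eps)%Re -> w (fun n => (Rabs (a n - L) < eps)%Re).

Section Cone.
Variables (P : word -> Prop) (S : seq word) (w : (nat -> Prop) -> Prop)
          (sc : nat -> R) (e : nat -> word).

Definition cone_point (x : nat -> word) : Prop :=
  (forall n, P (x n)) /\
  exists M, w (fun n => (INR (wdist S (x n) (e n)) / sc n <= M)%Re).

Definition cdist (x y : nat -> word) (L : R) : Prop :=
  ulim w (fun n => (INR (wdist S (x n) (y n)) / sc n)%Re) L.

Definition cut_point (p : nat -> word) : Prop :=
  cone_point p /\
  exists x y, cone_point x /\ cone_point y /\
    (exists L, (0 < L)%Re /\ cdist x p L) /\ (exists L, (0 < L)%Re /\ cdist y p L) /\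
    ~ exists f : R -> nat -> word,
        cdist (f 0%Re) x 0%Re /\ cdist (f 1%Re) y 0%Re /\
        (forall t, (0 <= t <= 1)%Re ->
           cone_point (f t) /\ exists L, (0 < L)%Re /\ cdist (f t) p L) /\
        (forall t, (0 <= t <= 1)%Re -> forall eps, (0 < eps)%Re ->
           exists del, (0 < del)%Re /\ forall t', (0 <= t' <= 1)%Re ->
             (Rabs (t - t') < del)%Re -> exists L, (L < eps)%Re /\ cdist (f t) (f t') L).
End Cone.

Definition no_cut_cones (P : word -> Prop) (S : seq word) : Prop :=
  forall (w : (nat -> Prop) -> Prop) (sc : nat -> R) (e : nat -> word),
    nonprincipal_ultrafilter w ->
    (forall n, (0 < sc n)%Re) -> (forall M, w (fun n => (M < sc n)%Re)) ->
    (forall n, P (e n)) ->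
    forall p, ~ cut_point P S w sc e p.

Definition wide (P : word -> Prop) : Prop :=
  exists S, generates P S /\ no_cut_cones P S.

Definition infinite_set (A : word -> Prop) : Prop :=
  ~ exists L : seq word, forall x, A x -> exists2 y, y \in L & weq x y.

Fixpoint dpath (S : seq word) (N : word -> Prop) (x : word) (l : seq word) (y : word) : Prop :=
  match l with
  | [::] => wdist S x y <= 1
  | z :: l' => N z /\ wdist S x z <= 1 /\ dpath S N z l' y
  end.

Definition nbhd (P : word -> Prop) (S : seq word) (C : R) (A : word -> Prop) (x : word) : Prop :=
  P x /\ exists y, A y /\ (INR (wdist S x y) <= C)%Re.

Definition path_connected_nbhd (P : word -> Prop) (S : seq word) (C : R) (A : word -> Prop) : Prop :=
  forall x y, nbhd P S C A x -> nbhd P S C A y ->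
    exists l, dpath S (nbhd P S C A) x l y.

Fixpoint linked (Rl : nat -> nat -> Prop) (i : nat) (ks : seq nat) (j : nat) : Prop :=
  match ks with
  | [::] => Rl i j
  | k :: ks' => Rl i k /\ linked Rl k ks' j
  end.

Definition gen_by (m : nat) (Hs : nat -> word -> Prop) (x : word) : Prop :=
  exists l : seq word, (forall u, u \in l -> exists2 i, i < m & Hs i u) /\ weq x (flatten l).

Definition finite_index (P K : word -> Prop) : Prop :=
  exists Rs : seq word, (forall r, r \in Rs -> P r) /\
    forall x, P x -> exists r h, [/\ r \in Rs, K h & weq x (r ++ h)].

Definition qgeod_in (P : word -> Prop) (S : seq word) (C : R) (H : word -> Prop) (x y : word) : Prop :=
  exists (a b : R) (g : R -> word),
    (a <= b)%Re /\ g a = x /\ g b = y /\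
    (forall t, (a <= t <= b)%Re -> nbhd P S C H (g t)) /\
    (forall t t', (a <= t <= b)%Re -> (a <= t' <= b)%Re ->
       (Rabs (t - t') <= C * (INR (wdist S (g t) (g t')) + C))%Re /\
       (INR (wdist S (g t) (g t')) <= C * Rabs (t - t') + C)%Re).

Fixpoint thick (n : nat) (P : word -> Prop) : Prop :=
  match n with
  | 0 => wide P
  | n'.+1 =>
      exists S, generates P S /\
      exists (m : nat) (Hs : nat -> word -> Prop) (C : R),
        (0 <= C)%Re /\
        (forall i, i < m -> [/\ subgroup (Hs i), subset_of (Hs i) P & thick n' (Hs i)]) /\
        finite_index P (gen_by m Hs) /\
        (forall i j, i < m -> j < m -> i = j \/
           exists ks : seq nat, all (fun k => k < m) ks /\
             linked (fun a b => infinite_set (fun z => Hs a z /\ Hs b z) /\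
                                path_connected_nbhd P S C (fun z => Hs a z /\ Hs b z)) i ks j) /\
        (forall i, i < m -> forall x y, Hs i x -> Hs i y -> qgeod_in P S C (Hs i) x y)
  end.

Definition strongly_thick (P : word -> Prop) : Prop := exists n, thick n P.

End RACG.

Definition W_all (G : graph) : word G -> Prop := fun _ => True.

(* Main.v *)
Require Import Defs.
From Stdlib Require Import Reals Lra ZArith Lia Relations Setoid Morphisms.
From Stdlib Require Import Classical ClassicalEpsilon.
From Stdlib Require Import FunctionalExtensionality PropExtensionality.
From HB Require Import structures.
From mathcomp Require Import all_boot zify_ssreflect.

(* Induct on the construction of the graph, proving more: whenever it occurs as the
   induced subgraph on [A] of a graph, every conjugate [g W_A g^-1] is thick of an order
   which depends on the abstract graph only.  This form makes a transport of thickness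
   along isomorphisms unnecessary.
   - For the 4-cycle the group is a product of two infinite dihedral groups, hence
     isometric to [Z^2] with the l1 metric; its cones are planes, which have no cut point.
   - For a cone with apex [v], the groups [W_{A-v}] and [v W_{A-v} v] generate a subgroup
     of index at most 2 and meet in [W_L], where [L] is the link of [v].
   - For a union, [W_A1] and [W_A2] generate, and they meet in the special subgroup on
     the intersection of [A1] and [A2].
   A special subgroup on a subset which is not a clique contains an infinite dihedral
   group.  Deleting the letters outside [B] is a retraction onto [W_B] that does not
   increase length, so special subgroups and their conjugates are quasiconvex. *)

Set Implicit Arguments.
Unset Strict Implicit.
Unset Printing Implicit Defensive.

(** * Words and special subgroups *)

#[local] Instance weq_equivalence (G : graph) : Equivalence (@weq G).
Proof.
split.
- by move=> x; apply: rst_refl.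
- by move=> x y; apply: rst_sym.
- by move=> x y z; apply: rst_trans.
Qed.

Lemma weq_morph (G G' : graph) (f : word G -> word G') (x y : word G) :
  (forall a b, racg_step a b -> weq (f a) (f b)) -> weq x y -> weq (f x) (f y).
Proof.
move=> fP; elim=> {x y} [x y /fP //|x|x y _ |x y z _ + _].
- exact: rst_refl.
- exact: rst_sym.
- exact: rst_trans.
Qed.

#[local] Instance cat_weq (G : graph) : Proper (@weq G ==> @weq G ==> @weq G) cat.
Proof.
move=> x x' xx' y y' yy'; transitivity (x' ++ y).
  apply: (weq_morph (f := fun z => z ++ y)) xx' => a b [u w s|u w s t st].
    by rewrite -!catA; apply/rst_step/step_cancel.
  by rewrite -!catA; apply/rst_step/step_comm.
apply: (weq_morph (f := cat x')) yy' => a b [u w s|u w s t st].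
  by rewrite 2!(catA x'); apply/rst_step/step_cancel.
by rewrite 2!(catA x'); apply/rst_step/step_comm.
Qed.

#[local] Instance cons_weq (G : graph) (s : gV G) : Proper (@weq G ==> @weq G) (cons s).
Proof. by move=> x y xy; apply: (cat_weq (x := [:: s]) (y := [:: s])) xy; reflexivity. Qed.

#[local] Instance rev_weq (G : graph) : Proper (@weq G ==> @weq G) rev.
Proof.
move=> x y; apply: weq_morph => a b [u w s|u w s t st]; rewrite !rev_cat -!catA.
  exact/rst_step/step_cancel.
by apply/rst_step/step_comm; rewrite gadj_sym.
Qed.

Lemma weq_refl (G : graph) (x : word G) : weq x x.
Proof. reflexivity. Qed.
#[local] Hint Resolve weq_refl : core.

Definition conjw (G : graph) (g w : word G) : word G := g ++ w ++ rev g.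

#[local] Instance conjw_weq (G : graph) (g : word G) : Proper (@weq G ==> @weq G) (conjw g).
Proof. by move=> x y xy; rewrite /conjw xy. Qed.

Section WordEquality.
Variable G : graph.
Implicit Types (s t v : gV G) (u w x y z g c : word G) (A B : {set gV G}).

Lemma weq_cancel s x : weq [:: s, s & x] x.
Proof. exact/rst_step/(step_cancel [::] x s). Qed.

Lemma weq_swap s t x : gadj s t -> weq [:: s, t & x] [:: t, s & x].
Proof. by move=> st; apply/rst_step/(step_comm [::] x st). Qed.

Lemma weq_catrev x y : weq (x ++ rev x ++ y) y.
Proof.
elim: x y => [|s x IH] y; first reflexivity.
by rewrite rev_cons -cats1 -!catA cat_cons IH /= weq_cancel.
Qed.

Lemma weq_revcat x y : weq (rev x ++ x ++ y) y.
Proof. by rewrite -{2}(revK x) weq_catrev. Qed.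

Lemma weq_catrev0 x : weq (x ++ rev x) [::].
Proof. by rewrite -[rev x]cats0 weq_catrev. Qed.

Lemma weq_revcat0 x : weq (rev x ++ x) [::].
Proof. by rewrite -{2}[x]cats0 weq_revcat. Qed.

Lemma weq_commute s w : all (gadj s) w -> weq (s :: w) (w ++ [:: s]).
Proof.
elim: w => [|t w IH] /=; first reflexivity.
by move=> /andP[st /IH sw]; rewrite weq_swap // sw.
Qed.

(** Killing the generators outside [A] sends each defining relation to a valid one; this gives the
    retraction onto the special subgroup on [A]. *)
Lemma weq_filter A x y : weq x y -> weq (filter [in A] x) (filter [in A] y).
Proof.
apply: weq_morph => a b [u w s|u w s t st]; rewrite !filter_cat /=.
  by case: (s \in A); rewrite //= weq_cancel.
by case: (s \in A); case: (t \in A); rewrite //= weq_swap.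
Qed.

(** Involutions that commute along edges satisfy the defining relations, so [act] is a group action
    and the fold depends on the group element only. *)
Lemma weq_foldr T (act : gV G -> T -> T) x y k :
    (forall s, involutive (act s)) ->
    (forall s t, gadj s t -> forall k, act s (act t k) = act t (act s k)) ->
  weq x y -> foldr act k x = foldr act k y.
Proof.
move=> actK actC; elim=> {x y} [x y|//|x y _ -> //|x y z _ -> _ -> //].
by case=> [u w s|u w s t st]; rewrite !foldr_cat /= ?actK ?(actC s t).
Qed.

Lemma conjw_comp g c w : conjw (g ++ c) w = conjw g (conjw c w).
Proof. by rewrite /conjw rev_cat -!catA. Qed.

Lemma rev_conjw g w : rev (conjw g w) = conjw g (rev w).
Proof. by rewrite /conjw !rev_cat revK catA. Qed.

Lemma conjw_cat g u w : weq (conjw g u ++ conjw g w) (conjw g (u ++ w)).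
Proof. by rewrite /conjw -!catA weq_revcat. Qed.

Lemma conjw_nil g : weq (conjw g [::]) [::].
Proof. exact: weq_catrev0. Qed.

Lemma conjw_revK g w : weq (rev g ++ conjw g w ++ g) w.
Proof. by rewrite /conjw -!catA weq_revcat weq_revcat0 cats0. Qed.

Lemma conjw_inj g u w : weq (conjw g u) (conjw g w) -> weq u w.
Proof. by move=> uw; rewrite -(conjw_revK g u) uw conjw_revK. Qed.

(* [g W_A g^-1], as a set of words. *)
Definition psub A g x : Prop := exists2 w, all [in A] w & weq x (conjw g w).
Definition pgen A g : seq (word G) := [seq conjw g [:: s] | s <- enum A].

Lemma psub_subgroup A g : subgroup (psub A g).
Proof.
split.
- by exists [::] => //; rewrite conjw_nil.
- move=> x y [u Au xu] [w Aw yw]; exists (u ++ w); first by rewrite all_cat Au.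
  by rewrite xu yw conjw_cat.
- by move=> x [u Au xu]; exists (rev u); rewrite ?all_rev // xu rev_conjw.
- by move=> x y xy [u Au xu]; exists u => //; rewrite -xy.
Qed.

Lemma psub_sub A B g c : all [in A] c -> B \subset A ->
  subset_of (psub B (g ++ c)) (psub A g).
Proof.
move=> Ac /subsetP BA x [u Bu xu]; exists (conjw c u).
  by rewrite !all_cat all_rev Ac (sub_all BA Bu).
by rewrite xu conjw_comp.
Qed.

(** The retraction onto [A] fixes the elements of $W_A$ and turns a word over [B] into a word over
    [A :&: B]. *)
Lemma psub_cap A B g :
  (fun z => psub A g z /\ psub B g z) = psub (A :&: B) g.
Proof.
apply: functional_extensionality => z; apply: propositional_extensionality; split.
  case=> -[u Au zu] [w Bw zw]; exists (filter [in A] w).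
    by apply/allP=> s; rewrite mem_filter inE => /andP[-> /(allP Bw)].
  have uw : weq u w by apply: (@conjw_inj g); rewrite -zu zw.
  have := weq_filter A uw; rewrite (all_filterP Au) => uw'.
  by rewrite zu uw'.
by case=> w Cw zw; split; exists w => //; apply: sub_all Cw => s /=; rewrite inE => /andP[].
Qed.

(** A conjugated generator is its own reverse, so the inverses allowed in [dle] add nothing, and a
    product of [k] generators is the conjugate of a word of length [k]. *)
Lemma all_pgen A g l : all (fun u => u \in pgen A g ++ map rev (pgen A g)) l ->
  exists w, [/\ size w = size l, all [in A] w & weq (flatten l) (conjw g w)].
Proof.
elim: l => [|u l IH] /=; first by exists [::]; split=> //; rewrite conjw_nil.
case/andP=> + /IH[w [sw Aw lw]].
have -> : map rev (pgen A g) = pgen A g.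
  by rewrite -map_comp; apply: eq_map => s /=; rewrite rev_conjw.
rewrite mem_cat orbb => /mapP[s]; rewrite mem_enum => As ->.
by exists (s :: w); rewrite /= As sw; split=> //; rewrite lw conjw_cat.
Qed.

Lemma pgen_all A g w : all [in A] w ->
  exists l, [/\ size l = size w,
    all (fun u => u \in pgen A g ++ map rev (pgen A g)) l &
    weq (conjw g w) (flatten l)].
Proof.
elim: w => [|s w IH] /=; first by exists [::]; split=> //; rewrite conjw_nil.
case/andP=> As /IH[l [sl Al wl]]; exists (conjw g [:: s] :: l) => /=.
have /mapP/= sg : exists2 t, t \in enum A & conjw g [:: s] = conjw g [:: t].
  by exists s; rewrite ?mem_enum.
rewrite sl Al mem_cat sg; split=> //.
by rewrite -wl conjw_cat.
Qed.

Lemma psub_generates A g : generates (psub A g) (pgen A g).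
Proof.
split=> [x /mapP[s]|x [w /(pgen_all g)[l [_ Al wl]] xw]].
  by rewrite mem_enum => As ->; exists [:: s]; [rewrite /= As | reflexivity].
by exists l; split=> //; rewrite xw.
Qed.

Lemma ex_least (Q : nat -> Prop) : (exists k, Q k) ->
  exists k, Q k /\ forall j, Q j -> k <= j.
Proof.
case=> k; elim/ltn_ind: k => k IH Qk.
case: (classic (exists2 j, j < k & Q j)) => [[j jk /IH]|noj]; first exact.
exists k; split=> // j Qj; rewrite leqNgt; apply/negP=> jk.
by apply: noj; exists j.
Qed.

(** [wdist] is chosen by [epsilon], hence is a least length only when some expression exists; the
    hypothesis supplies one. *)
Lemma wdistP S x y : (exists k, dle S x y k) ->
  forall k, wdist S x y <= k <-> dle S x y k.
Proof.
move=> /ex_least dS k.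
have [kP minP] := epsilon_spec (inhabits 0) _ dS.
split=> [le|/minP //]; case: kP => l [sl lP].
by exists l; split=> //; apply: leq_trans sl le.
Qed.

(** Conjugation by [g] matches letters with generators, so distances in $gW_Ag^{-1}$ are lengths of
    $u^{-1}w$ over the alphabet [A]. *)
Lemma wdist_leP A g x y u w k :
    all [in A] u -> all [in A] w -> weq x (conjw g u) -> weq y (conjw g w) ->
  wdist (pgen A g) x y <= k <->
  exists w', [/\ size w' <= k, all [in A] w' & weq (rev u ++ w) w'].
Proof.
move=> Au Aw xu yw.
have E : weq (rev x ++ y) (conjw g (rev u ++ w)) by rewrite xu yw rev_conjw conjw_cat.
have dleP j : dle (pgen A g) x y j <->
    exists w', [/\ size w' <= j, all [in A] w' & weq (rev u ++ w) w'].
  split=> [[l [sl [/all_pgen[w' [sw' Aw' lw']] lP]]]|[w' [sw' Aw' ww']]].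
    exists w'; split=> //; first by rewrite sw'.
    by apply: (@conjw_inj g); rewrite -E lP.
  have [l [sl Al wl]] := pgen_all g Aw'.
  by exists l; rewrite sl; split=> //; split=> //; rewrite E ww'.
rewrite wdistP ?dleP //; exists (size (rev u ++ w)); apply/dleP.
by exists (rev u ++ w); rewrite all_cat all_rev Au; split=> //; reflexivity.
Qed.

Lemma wdist_sym A g x y : psub A g x -> psub A g y ->
  wdist (pgen A g) x y = wdist (pgen A g) y x.
Proof.
have le x' y' : psub A g x' -> psub A g y' ->
    wdist (pgen A g) x' y' <= wdist (pgen A g) y' x'.
  move=> [u Au xu] [w Aw yw]; apply/(wdist_leP _ Au Aw xu yw).
  have /(wdist_leP _ Aw Au yw xu)[w' [sw' Aw' ww']] := leqnn (wdist (pgen A g) y' x').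
  exists (rev w'); rewrite size_rev all_rev; split=> //.
  by rewrite -ww' rev_cat revK; reflexivity.
by move=> Px Py; apply/eqP; rewrite eqn_leq !le.
Qed.

End WordEquality.

(** * Geodesics and quasiconvexity *)

Section Geometry.
Variable G : graph.
Implicit Types (s t v : gV G) (u w x y z g c : word G) (A B : {set gV G}).
Implicit Types (S l : seq (word G)) (N : word G -> Prop).

Lemma all_take (T : Type) (p : pred T) i (r : seq T) : all p r -> all p (take i r).
Proof. by rewrite -{1}(cat_take_drop i r) all_cat => /andP[]. Qed.

Lemma all_drop (T : Type) (p : pred T) i (r : seq T) : all p r -> all p (drop i r).
Proof. by rewrite -{1}(cat_take_drop i r) all_cat => /andP[]. Qed.

Lemma dpath_cat S N x l z l' y :
  dpath S N x l z -> N z -> dpath S N z l' y -> dpath S N x (l ++ z :: l') y.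
Proof. by elim: l x => //= a l IH x [Na [xa /IH H]] Nz /(H Nz). Qed.

Lemma dpath_word A g N x y u w :
    all [in A] u -> all [in A] w ->
    weq x (conjw g u) -> weq y (conjw g (u ++ w)) ->
    (forall i z, weq z (conjw g (u ++ take i w)) -> N z) ->
  exists l, dpath (pgen A g) N x l y.
Proof.
elim: w u x => [|s w IH] u x Au /=.
  rewrite cats0 => _ xu yu _; exists [::] => /=.
  by apply/(wdist_leP _ Au Au xu yu); exists [::]; split=> //; rewrite weq_revcat0.
case/andP=> As Aw xu yw Nw.
have Aus : all [in A] (u ++ [:: s]) by rewrite all_cat Au /= As.
have [|i z zE|l lP] := IH _ (conjw g (u ++ [:: s])) Aus Aw (weq_refl _).
- by rewrite -catA.
- by apply: (Nw i.+1); rewrite zE -catA.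
exists (conjw g (u ++ [:: s]) :: l); split; first by apply: (Nw 1); rewrite /= take0.
split=> //; apply/(wdist_leP _ Au Aus xu (weq_refl _)).
by exists [:: s]; rewrite /= As; split=> //; rewrite weq_revcat.
Qed.

(** With [a] and [b] in the subgroup within [C] of [x] and [y], the path runs from [x] to [a],
    inside the subgroup to [b], then out to [y]. *)
Lemma psub_path_connected A B g (C : R) : B \subset A -> (0 <= C)%Re ->
  path_connected_nbhd (psub A g) (pgen A g) C (psub B g).
Proof.
move=> /subsetP BA C0 x y [[u Au xu] [a [[p Bp ap] xa]]] [[w Aw yw] [b [[q Bq bq] yb]]].
have Ap := sub_all BA Bp; have Aq := sub_all BA Bq.
have [w1 [s1 A1 E1]] := (wdist_leP _ Au Ap xu ap).1 (leqnn _).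
have [w2 [s2 A2 E2]] := (wdist_leP _ Aw Aq yw bq).1 (leqnn _).
set N := nbhd _ _ _ _.
have Nab i z : weq z (conjw g (p ++ take i (rev p ++ q))) -> N z.
  have Br : all [in B] (p ++ take i (rev p ++ q)).
    by rewrite all_cat Bp all_take // all_cat all_rev Bp.
  have Ar := sub_all BA Br.
  move=> zE; split; first by eexists; eauto.
  exists z; split; first by eexists; eauto.
  have : wdist (pgen A g) z z <= 0.
    by apply/(wdist_leP _ Ar Ar zE zE); exists [::]; split=> //; rewrite weq_revcat0.
  by rewrite leqn0 => /eqP->.
have Nb : N b by apply: (Nab (size (rev p ++ q))); rewrite take_size weq_catrev.
have Na : N a by apply: (Nab 0); rewrite take0 cats0.
have [|i z zE|l1 P1] := @dpath_word A g N x a u w1 Au A1 xu.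
- by rewrite -E1 weq_catrev.
- have Ar : all [in A] (u ++ take i w1) by rewrite all_cat Au all_take.
  split; first by eexists; eauto.
  exists a; split; first by exists p.
  apply: Rle_trans xa; apply/le_INR/leP.
  (* The rest of [w1] leads from here to [a] and is no longer than the distance from [x] to [a]. *)
  apply/(wdist_leP _ Ar Ap zE ap); exists (drop i w1).
  rewrite size_drop all_drop // (leq_trans (leq_subr _ _) s1); split=> //.
  have pE : weq p (u ++ take i w1 ++ drop i w1) by rewrite cat_take_drop -E1 weq_catrev.
  by rewrite pE (catA u) weq_revcat.
have [||l2 P2] := @dpath_word A g N a b p (rev p ++ q) Ap _ ap _ Nab.
- by rewrite all_cat all_rev Ap.
- by rewrite weq_catrev.
have [||i z zE|l3 P3] := @dpath_word A g N b y q (rev w2) Aq _ bq.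
- by rewrite all_rev.
- by rewrite -E2 rev_cat revK weq_catrev.
- have Ar : all [in A] (q ++ take i (rev w2)) by rewrite all_cat Aq all_take // all_rev.
  split; first by eexists; eauto.
  exists b; split; first by exists q.
  apply: Rle_trans yb; apply/le_INR/leP.
  apply/(wdist_leP _ Ar Aq zE bq); exists (rev (take i (rev w2))).
  rewrite size_rev all_rev all_take ?all_rev //; split=> //.
    by rewrite (leq_trans _ s2) // size_take_min size_rev geq_minr.
  by rewrite rev_cat -catA weq_revcat0 cats0.
by exists (l1 ++ a :: l2 ++ b :: l3); do !apply: dpath_cat => //.
Qed.

(** [b] is a shortest word over [B] for $u^{-1}w$; a shorter word equal to one of its factors could
    be substituted to shorten [b]. *)
Lemma psub_geodesic B u w : all [in B] u -> all [in B] w ->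
  exists b, [/\ all [in B] b, weq w (u ++ b) &
    forall i j m, all [in B] m -> weq m (drop i (take j b)) ->
      size (drop i (take j b)) <= size m].
Proof.
move=> Bu Bw.
pose Q k := exists b, [/\ size b = k, all [in B] b & weq (rev u ++ w) b].
have /ex_least[k [[b [bk Bb wb]] minb]] : exists k, Q k.
  by exists (size (rev u ++ w)), (rev u ++ w); rewrite all_cat all_rev Bu.
exists b; split=> // [|i j m Bm mE]; first by rewrite -wb weq_catrev.
have : k <= size (take i (take j b) ++ m ++ drop j b).
  apply: minb; eexists; split; first reflexivity.
    by rewrite !all_cat Bm !all_take ?all_drop.
  by rewrite wb mE (catA (take i _)) !cat_take_drop.
rewrite -bk -{1}(cat_take_drop j b) -{1}(cat_take_drop i (take j b)) !size_cat.
lia.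
Qed.

(** Conjugating by [c] costs at most [2 * size c] letters, whence the upper bound. For the lower
    bounds, a word over [A] is conjugated back and loses its letters outside [B]; what remains
    represents a factor of [b], which is shortest over [B]. *)
Lemma geodesic_wdist A B g c u b i j z z' :
    all [in A] c -> B \subset A -> all [in B] u -> all [in B] b ->
    (forall i j m, all [in B] m -> weq m (drop i (take j b)) ->
      size (drop i (take j b)) <= size m) ->
    i <= size b -> j <= size b ->
    weq z (conjw (g ++ c) (u ++ take i b)) -> weq z' (conjw (g ++ c) (u ++ take j b)) ->
  let d := wdist (pgen A g) z z' in
  [/\ i <= j + d + 2 * size c, j <= i + d + 2 * size c &
      d <= (i - j) + (j - i) + 2 * size c].
Proof.
move=> Ac /subsetP BA Bu Bb minb.
have Au := sub_all BA Bu; have Ab := sub_all BA Bb.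
have Ar k : all [in A] (conjw c (u ++ take k b)).
  by rewrite !all_cat all_rev Ac Au all_take.
wlog ij : i j z z' / i <= j => [H ib jb zE zE' /=|ib jb zE zE' /=].
  case: (leqP i j) => [|/ltnW] ij; first exact: H.
  have [||||h1 h2 h3] := H j i z' z ij _ _ _ _ => //.
  rewrite wdist_sym; first by split; lia.
    by exists (conjw c (u ++ take i b)); rewrite // zE conjw_comp.
  by exists (conjw c (u ++ take j b)); rewrite // zE' conjw_comp.
rewrite conjw_comp in zE; rewrite conjw_comp in zE'.
have E : weq (rev (conjw c (u ++ take i b)) ++ conjw c (u ++ take j b))
             (conjw c (drop i (take j b))).
  rewrite rev_conjw conjw_cat rev_cat -!catA weq_revcat.
  by rewrite -{1}(cat_take_drop i (take j b)) take_takel // weq_revcat.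
have sz : size (drop i (take j b)) = j - i by rewrite size_drop size_takel.
have up : wdist (pgen A g) z z' <= j - i + 2 * size c.
  apply/(wdist_leP _ (Ar i) (Ar j) zE zE'); exists (conjw c (drop i (take j b))).
  rewrite !size_cat sz size_rev !all_cat all_rev Ac all_drop ?all_take //.
  by split=> //; lia.
have [w' [sw' Aw' wE]] := (wdist_leP _ (Ar i) (Ar j) zE zE').1 (leqnn _).
have := minb i j (filter [in B] (rev c ++ w' ++ c)) (filter_all _ _).
rewrite sz => lo; split; try lia.
have {lo} : j - i <= size (filter [in B] (rev c ++ w' ++ c)).
  apply: lo.
  have Bd : all [in B] (drop i (take j b)) by rewrite all_drop ?all_take.
  rewrite -[X in weq _ X](all_filterP Bd); apply: weq_filter.
  by rewrite -wE E conjw_revK.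
have := count_size [in B] (rev c ++ w' ++ c).
by rewrite -size_filter !size_cat size_rev; lia.
Qed.

Lemma nat_floor k (t : R) : (0 <= t <= INR k + 1)%Re ->
  exists i, i <= k /\ (INR i <= t <= INR i + 1)%Re.
Proof.
elim: k => [|k IH]; first by exists 0.
rewrite S_INR => tk; case: (Rle_dec t (INR k + 1)) => tk'.
  by case: IH => [|i [ik it]]; [lra|exists i; split=> //; apply: leqW].
by exists k.+1; rewrite S_INR; split=> //; lra.
Qed.

(** The path rests at [u ++ take i b] on the unit interval starting at [i]. Rounding changes
    parameter differences by at most 1, and [c] contributes [2 * size c]. *)
Lemma psub_qgeod A B g c (C : R) x y :
    all [in A] c -> B \subset A -> (INR (2 * size c) + 3 <= C)%Re ->
    psub B (g ++ c) x -> psub B (g ++ c) y ->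
  qgeod_in (psub A g) (pgen A g) C (psub B (g ++ c)) x y.
Proof.
move=> Ac BA CD [u Bu xu] [w Bw yw].
have [b [Bb wb minb]] := psub_geodesic Bu Bw.
have L0 := pos_INR (size b); have D0 := pos_INR (2 * size c).
set D := INR (2 * size c) in CD D0.
(* The extra unit gives the last vertex an interval and keeps [0] and [L] distinct when [b] is
   empty. *)
set L := (INR (size b) + 1)%Re.
(* The ends must be the very words [x] and [y], not just words equal to them in the group, hence the
   last two clauses. *)
pose Q (t : R) z := [/\ exists i, [/\ i <= size b, (INR i <= t <= INR i + 1)%Re &
                     weq z (conjw (g ++ c) (u ++ take i b))],
                t = 0%Re -> z = x & t = L -> z = y].
have Qex (t : R) : (0 <= t <= L)%Re -> exists z, Q t z.
  move=> tL; case: (Req_dec t 0) => [t0|t0].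
    exists x; split=> //; last by rewrite /L; lra.
    by exists 0; rewrite take0 cats0; split=> //=; lra.
  case: (Req_dec t L) => [t1|t1].
    exists y; split=> //; exists (size b); split=> //.
      by rewrite t1 /L; lra.
    by rewrite take_size -wb.
  have [i [ib it]] := nat_floor tL.
  by exists (conjw (g ++ c) (u ++ take i b)); split=> //; exists i.
pose f (t : R) := epsilon (inhabits ([::] : word G)) (Q t).
have fQ (t : R) : (0 <= t <= L)%Re -> Q t (f t) by move/Qex; apply: epsilon_spec.
exists 0%Re, L, f; rewrite /L in fQ *.
have [|_ -> // _] := fQ 0%Re; first lra.
have [|_ _ -> //] := fQ L; first by rewrite /L; lra.
split; first lra.
do 2!split=> //; split.
  move=> t /fQ[[i [ib _ zE]] _ _].
  have Bz : psub B (g ++ c) (f t) by eexists; last exact: zE; rewrite all_cat Bu all_take.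
  split; first exact: psub_sub Bz.
  exists (f t); split=> //.
  have [_ _] := geodesic_wdist Ac BA Bu Bb minb ib ib zE zE.
  rewrite subnn => /leP/le_INR; rewrite -/D => ?; lra.
move=> t t' /fQ[[i [ib it zE]] _ _] /fQ[[j [jb jt zE']] _ _].
have [] := geodesic_wdist Ac BA Bu Bb minb ib jb zE zE'.
set d := wdist _ _ _; rewrite /d -/d.
move=> /leP/le_INR + /leP/le_INR.
rewrite !(plus_INR _ (2 * size c)) !(plus_INR _ d) -/D => h1 h2 h3.
have h4 : (INR d <= Rabs (INR i - INR j) + D)%Re.
  case: (leqP i j) h3 => [|/ltnW] ij.
    have -> : (i - j = 0)%N by lia.
    rewrite add0n => /leP/le_INR; rewrite plus_INR minus_INR; last exact/leP.
    by rewrite -/D; have := Rle_abs (- (INR i - INR j)); rewrite Rabs_Ropp; lra.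
  have -> : (j - i = 0)%N by lia.
  rewrite addn0 => /leP/le_INR; rewrite plus_INR minus_INR; last exact/leP.
  by rewrite -/D; have := Rle_abs (INR i - INR j); lra.
have d0 := pos_INR d; split.
  have : (Rabs (t - t') <= INR d + C)%Re by apply: Rabs_le; lra.
  have : (0 <= (C - 1) * (INR d + C))%Re by apply: Rmult_le_pos; lra.
  lra.
have : (Rabs (INR i - INR j) <= Rabs (t - t') + 1)%Re.
  apply: Rabs_le; have := Rle_abs (t - t'); have := Rle_abs (- (t - t')).
  by rewrite Rabs_Ropp; lra.
have : (0 <= (C - 1) * Rabs (t - t'))%Re.
  by apply: Rmult_le_pos; [lra|exact: Rabs_pos].
lra.
Qed.

End Geometry.

(** * Cones, unions and infinite dihedral subgroups *)

Section Combinatorics.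
Variable G : graph.
Implicit Types (r s t v : gV G) (u w x y z g c : word G) (A B D : {set gV G}).

(* Reads [w] in the double of the graph along the link of [v], where [v] acts by
   swapping the two copies, then projects the double to its first copy; [b] records
   whether the current letter lies in the second copy. *)
Fixpoint unfold_at v (b : bool) w : word G :=
  match w with
  | [::] => [::]
  | s :: w' =>
      if s == v then unfold_at v (~~ b) w'
      else if b && ~~ gadj v s then unfold_at v b w' else s :: unfold_at v b w'
  end.

(** Two occurrences of [v] switch copies twice; a letter adjacent to [v] belongs to both copies and
    is kept in either, so it may pass [v]. *)
Lemma unfold_at_weq v b x y : weq x y -> weq (unfold_at v b x) (unfold_at v b y).
Proof.
apply: weq_morph => _ _ [u w s|u w s t st]; elim: u b => [|r u IH] b /=.
- case: eqP => _; first by rewrite negbK.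
  by case: (b && _); rewrite // weq_cancel.
- by do 2?case: ifP => _ //; rewrite IH.
- case: (s =P v) => [sv|_]; case: (t =P v) => [tv|_].
  + by rewrite sv tv gadj_irr in st.
  + by rewrite -sv st !andbF.
  + by rewrite -tv gadj_sym st !andbF.
  by case: (b && ~~ gadj v s); case: (b && ~~ gadj v t); rewrite // weq_swap.
- by do 2?case: ifP => _ //; rewrite IH.
Qed.

Lemma unfold_at_false v w : v \notin w -> unfold_at v false w = w.
Proof.
elim: w => //= s w IH; rewrite inE negb_or eq_sym => /andP[/negPf-> /IH->] //.
Qed.

Lemma unfold_at_true v w : v \notin w ->
  unfold_at v true (w ++ [:: v]) = filter (gadj v) w.
Proof.
elim: w => [|s w IH] /=; first by rewrite eqxx.
by rewrite inE negb_or eq_sym => /andP[/negPf-> /IH->]; case: (gadj v s).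
Qed.

(** Conjugated back by [g], a common element is $u = v w v$ with [u] and [w] avoiding [v]. Unfolding
    leaves [u] as it is and reads [w] in the second copy, where only letters of the link survive. *)
Lemma psub_cap_conj A g v :
  (fun z => psub (A :\ v) g z /\ psub (A :\ v) (g ++ [:: v]) z) =
  psub [set s in A | gadj v s] g.
Proof.
apply: functional_extensionality => z; apply: propositional_extensionality; split.
  case=> -[u Au zu] [w Aw zw].
  have nv x : all [in A :\ v] x -> v \notin x.
    by move=> /allP Ax; apply/negP=> /Ax; rewrite !inE eqxx.
  have uw : weq u (v :: w ++ [:: v]).
    by apply: (@conjw_inj _ g); rewrite -zu zw conjw_comp.
  have := unfold_at_weq v false uw.
  rewrite unfold_at_false ?nv //= eqxx unfold_at_true ?nv // => uw'.
  exists (filter (gadj v) w); last by rewrite zu uw'.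
  apply/allP=> s; rewrite mem_filter inE => /andP[-> /(allP Aw)].
  by rewrite !inE => /andP[_ ->].
case=> w Lw zw.
have Aw : all [in A :\ v] w.
  apply: sub_all Lw => s; rewrite !inE => /andP[-> vs]; rewrite andbT.
  by apply: contraTneq vs => ->; rewrite gadj_irr.
split; exists w => //; rewrite conjw_comp zw; apply: conjw_weq.
rewrite /conjw /= -weq_commute ?weq_cancel //.
by apply: sub_all Lw => s; rewrite inE => /andP[].
Qed.

(* The infinite dihedral group [<s, t>] acts simply transitively on [Z]; the
   remaining generators act trivially. *)
Definition refl s t r (k : Z) : Z :=
  if r == s then (1 - k)%Z else if r == t then (-1 - k)%Z else k.

Lemma refl_foldr s t x y k : ~~ gadj s t -> weq x y ->
  foldr (refl s t) k x = foldr (refl s t) k y.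
Proof.
move=> st; apply: weq_foldr => [r i|r r' rr' i].
  by rewrite /refl; case: (r == s); case: (r == t); lia.
rewrite /refl.
case: (r =P s) => [rs|_]; case: (r' =P s) => [rs'|_] //;
  case: (r =P t) => [rt|_]; case: (r' =P t) => [rt'|_] //; subst;
  by move: rr'; rewrite ?(gadj_sym t) ?(negPf st) ?gadj_irr.
Qed.

Lemma refl_foldr_dist s t x i j :
  Z.abs (foldr (refl s t) i x - foldr (refl s t) j x) = Z.abs (i - j).
Proof.
elim: x => //= r x <-; rewrite /refl.
by case: (r == s); case: (r == t); lia.
Qed.

Fixpoint alternate s t n : word G :=
  if n is n'.+1 then s :: alternate t s n' else [::].

(** For distinct [s] and [t], the alternating word of length $|k|$ that takes 0 to [k] under
    [refl]. *)
Definition dihedral s t (k : Z) : word G :=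
  if (0 <? k)%Z then alternate s t (Z.to_nat k) else alternate t s (Z.to_nat (- k)).

Lemma size_dihedral s t k : size (dihedral s t k) = Z.abs_nat k.
Proof.
have sz n : forall s' t', size (alternate s' t' n) = n by elim: n => //= n IH *; rewrite IH.
by rewrite /dihedral; case: Z.ltb_spec => ?; rewrite sz; lia.
Qed.

Lemma all_dihedral (p : pred (gV G)) s t k : p s -> p t -> all p (dihedral s t k).
Proof.
have al n : forall s' t', p s' -> p t' -> all p (alternate s' t' n).
  by elim: n => //= n IH s' t' ps pt; rewrite ps IH.
by move=> ps pt; rewrite /dihedral; case: ifP => _; apply: al.
Qed.

Lemma dihedral_l s t k : weq (s :: dihedral s t k) (dihedral s t (1 - k)).
Proof.
rewrite /dihedral; case: Z.ltb_spec => k0; case: Z.ltb_spec => k1; try lia.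
  have -> : Z.to_nat k = (Z.to_nat (- (1 - k))).+1 by lia.
  by rewrite /= weq_cancel.
by have -> : Z.to_nat (1 - k) = (Z.to_nat (- k)).+1 by lia.
Qed.

Lemma dihedral_r s t k : weq (t :: dihedral s t k) (dihedral s t (- 1 - k)).
Proof.
rewrite /dihedral; case: Z.ltb_spec => k0; case: Z.ltb_spec => k1; try lia.
- by have -> : Z.to_nat (- (-1 - k)) = (Z.to_nat k).+1 by lia.
- have -> : Z.to_nat (- k) = (Z.to_nat (- 1 - k)).+1 by lia.
  by rewrite /= weq_cancel.
have [->|->] : (k = 0 \/ k = -1)%Z by lia.
  by [].
by rewrite /= weq_cancel.
Qed.

Lemma refl_dihedral s t k : s != t -> foldr (refl s t) 0%Z (dihedral s t k) = k.
Proof.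
move=> st; have alt n : foldr (refl s t) 0%Z (alternate s t n) = Z.of_nat n /\
    foldr (refl s t) 0%Z (alternate t s n) = (- Z.of_nat n)%Z.
  elim: n => //= n [-> ->]; rewrite /refl !eqxx eq_sym (negPf st); lia.
by rewrite /dihedral; case: Z.ltb_spec => k0; rewrite ?(alt _).1 ?(alt _).2; lia.
Qed.

(** The images of 0 under the elements of a finite list are bounded, while [dihedral s t M] takes 0
    to any prescribed [M]. *)
Lemma psub_infinite A g : not_clique A -> infinite_set (psub A g).
Proof.
case=> s [t [As At st nst]] [L LP].
pose h x := foldr (refl s t) 0%Z (rev g ++ x ++ g).
have [M ML] : exists M, forall x, x \in L -> (h x < M)%Z.
  elim: L {LP} => [|a L [M ML]]; first by exists 0%Z.
  exists (Z.max M (h a + 1)) => x; rewrite inE => /predU1P[->|/ML]; lia.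
have [|x /ML hx /= xE] := LP (conjw g (dihedral s t M)).
  by exists (dihedral s t M) => //; apply: all_dihedral.
suff : h x = M by lia.
rewrite /h -(refl_dihedral M st); apply: refl_foldr => //.
by rewrite -xE conjw_revK.
Qed.

(** * Generation by two subgroups, finite index and thickness *)

Lemma gen_by_cat m Hs x y :
  @gen_by G m Hs x -> gen_by m Hs y -> gen_by m Hs (x ++ y).
Proof.
move=> [l [lH xl]] [l' [lH' yl]]; exists (l ++ l'); split; last by rewrite flatten_cat xl yl.
by move=> u; rewrite mem_cat => /orP[/lH|/lH'].
Qed.

Lemma gen_by_weq m Hs x y : weq x y -> @gen_by G m Hs x -> gen_by m Hs y.
Proof. by move=> xy [l [lH xl]]; exists l; rewrite -xy. Qed.

Lemma gen_by_mem m Hs i x : i < m -> Hs i x -> @gen_by G m Hs x.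
Proof.
move=> im Hx; exists [:: x]; rewrite /= cats0; split=> // u.
by rewrite inE => /eqP->; exists i.
Qed.

Lemma gen_by_nil m Hs : @gen_by G m Hs [::].
Proof. by exists [::]. Qed.

Definition pair_of (H0 H1 : word G -> Prop) (i : nat) := if i is 0 then H0 else H1.

Lemma finite_index_union A A1 A2 g : A1 :|: A2 = A ->
  finite_index (psub A g) (gen_by 2 (pair_of (psub A1 g) (psub A2 g))).
Proof.
move=> <-; exists [:: [::]]; split=> [r|x [w Aw xw]].
  by rewrite inE => /eqP->; case: (psub_subgroup (A1 :|: A2) g).
exists [::], x; split=> //; apply: gen_by_weq (symmetry xw) _.
elim: w Aw {x xw} => [_|s w IH /= /andP[As /IH Hw]].
  by apply: gen_by_weq (gen_by_nil _ _); rewrite conjw_nil.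
apply: (gen_by_weq (conjw_cat g [:: s] w)); apply: gen_by_cat Hw.
move: As; rewrite inE => /orP[] As;
  [apply: (@gen_by_mem _ _ 0)|apply: (@gen_by_mem _ _ 1)] => //;
  by exists [:: s]; rewrite //= As.
Qed.

(* The subgroup in question is the kernel of the character sending [v] to [-1]
   and the other generators to [1]. *)
Lemma finite_index_cone A g v : v \in A ->
  finite_index (psub A g)
    (gen_by 2 (pair_of (psub (A :\ v) g) (psub (A :\ v) (g ++ [:: v])))).
Proof.
move=> Av; set K := gen_by _ _; exists [:: [::]; conjw g [:: v]]; split=> [r|x [w Aw xw]].
  rewrite !inE => /orP[] /eqP->; first by case: (psub_subgroup A g).
  by exists [:: v]; rewrite //= Av.
(* The empty word and [v] represent the cosets: by induction on [w], either [w] or [v :: w] lies in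
   [K] after conjugation by [g]. *)
suff [Kw|Kw] : K (conjw g w) \/ K (conjw g (v :: w)).
- by exists [::], (conjw g w); rewrite inE.
- exists (conjw g [:: v]), (conjw g (v :: w)); rewrite !inE eqxx orbT; split=> //.
  by rewrite conjw_cat /= weq_cancel.
elim: w Aw {x xw} => [_|s w IH /= /andP[As /IH{IH}]].
  by left; apply: gen_by_weq (gen_by_nil _ _); rewrite conjw_nil.
case: (s =P v) => [->|/eqP sv].
  case=> Kw; [right|by left].
  by apply: gen_by_weq Kw; rewrite weq_cancel.
have Bs : all [in A :\ v] [:: s] by rewrite /= !inE sv As.
case=> Kw; [left|right].
  apply: (gen_by_weq (conjw_cat g [:: s] w)); apply: gen_by_cat Kw.
  by apply: (@gen_by_mem _ _ 0) => //; exists [:: s].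
(* $v s w = (v s v)(v w)$, and $v s v$ lies in the second subgroup. *)
have E : weq (conjw (g ++ [:: v]) [:: s] ++ conjw g (v :: w)) (conjw g [:: v, s & w]).
  by rewrite conjw_comp conjw_cat /conjw /= weq_cancel.
apply: (gen_by_weq E); apply: gen_by_cat Kw.
by apply: (@gen_by_mem _ _ 1) => //; exists [:: s].
Qed.

(** Common form of both inductive cases: [c] is the apex for a cone and empty for a union, and [D]
    spans the intersection of the two subgroups. *)
Lemma thick_two n A B1 B2 D g c :
    all [in A] c -> size c <= 1 -> B1 \subset A -> B2 \subset A -> D \subset A ->
    thick n (psub B1 g) -> thick n (psub B2 (g ++ c)) ->
    (fun z => psub B1 g z /\ psub B2 (g ++ c) z) = psub D g ->
    infinite_set (psub D g) ->
    finite_index (psub A g) (gen_by 2 (pair_of (psub B1 g) (psub B2 (g ++ c)))) ->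
  thick n.+1 (psub A g).
Proof.
move=> Ac c1 B1A B2A DA th1 th2 capD infD fi.
exists (pgen A g); split; first exact: psub_generates.
(* As [size c <= 1], the quasigeodesic constant [2 * size c + 3] is at most 5. *)
exists 2, (pair_of (psub B1 g) (psub B2 (g ++ c))), 5%Re; split; first lra.
have sub1 : subset_of (psub B1 g) (psub A g).
  by rewrite -{1}[g]cats0; apply: psub_sub.
have pc : path_connected_nbhd (psub A g) (pgen A g) 5%Re (psub D g).
  by apply: psub_path_connected => //; lra.
have capD' : (fun z => psub B2 (g ++ c) z /\ psub B1 g z) = psub D g.
  by rewrite -capD; apply: functional_extensionality => z;
    apply: propositional_extensionality; split=> -[].
split; [|split=> //; split].
- case=> [|[|//]] _ /=; split=> //; try exact: psub_subgroup.
  exact: psub_sub.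
- case=> [|[|//]] [|[|//]] _ _ /=; [by left| | |by left].
    by right; exists [::] => /=; rewrite capD.
  by right; exists [::] => /=; rewrite capD'.
case=> [|[|//]] _ /= x y Hx Hy.
  rewrite -[X in psub B1 X]cats0; apply: psub_qgeod; rewrite ?cats0 //=; lra.
apply: psub_qgeod => //.
by move: c1; case: (c) => [|? [|? ?]] //= _; lra.
Qed.

(** The group itself serves as the only member of the collection, so no chains have to be found. *)
Lemma thickS n A g : thick n (psub A g) -> thick n.+1 (psub A g).
Proof.
move=> th; exists (pgen A g); split; first exact: psub_generates.
exists 1, (fun _ => psub A g), 3%Re; split; first lra.
have := psub_subgroup A g; split; first by split.
split.
  exists [:: [::]]; split=> [r|x Px]; first by rewrite inE => /eqP->; case: H.
  by exists [::], x; split=> //; apply: (@gen_by_mem _ _ 0).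
split; first by case=> [|//] [|//] _ _; left.
move=> _ _ x y Hx Hy.
rewrite -[X in qgeod_in _ _ _ (psub A X)]cats0.
by apply: psub_qgeod; rewrite ?cats0 //=; lra.
Qed.

Lemma thick_leq n m A g : n <= m -> thick n (psub A g) -> thick m (psub A g).
Proof. by move=> /subnK<-; elim: (m - n) => // k IH /IH/thickS. Qed.

End Combinatorics.

(** * The square: asymptotic cones are planes *)

Section Cones.
Variable w : (nat -> Prop) -> Prop.
Hypothesis uw : nonprincipal_ultrafilter w.
Local Open Scope R_scope.
Implicit Types (a b : nat -> R) (A B C : nat -> Prop).

Lemma ultra_mono A B : w A -> (forall n, A n -> B n) -> w B.
Proof. by case: uw => _ [_ [h _]]; apply: h. Qed.

Lemma ultra_mono2 A B C : w A -> w B -> (forall n, A n -> B n -> C n) -> w C.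
Proof.
case: uw => _ [_ [_ [h _]]] wA wB ABC.
by apply: ultra_mono (h _ _ wA wB) _ => n [/ABC H /H].
Qed.

Lemma ultra_ex A : w A -> exists n, A n.
Proof.
move=> wA; apply: NNPP => nA; case: uw => _ [w0 _]; apply: w0.
by apply: ultra_mono wA _ => n An; apply: nA; exists n.
Qed.

Lemma ulim_unique a L L' : ulim w a L -> ulim w a L' -> L = L'.
Proof.
move=> aL aL'; apply: NNPP => LL'.
have e0 : 0 < Rabs (L - L') / 2.
  by have := Rabs_pos_lt (L - L'); lra.
have [n [h1 h2]] : exists n, Rabs (a n - L) < Rabs (L - L') / 2 /\
    Rabs (a n - L') < Rabs (L - L') / 2.
  by apply: ultra_ex; apply: ultra_mono2 (aL _ e0) (aL' _ e0) _.
have := Rabs_triang (L - a n) (a n - L').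
have -> : L - a n + (a n - L') = L - L' by ring.
by rewrite (Rabs_minus_sym L (a n)); lra.
Qed.

(** The limit is the supremum of the reals lying below the sequence [w]-almost everywhere; the
    ultrafilter dichotomy gives the bound from above. *)
Lemma ulim_bounded a M : w (fun n => Rabs (a n) <= M) -> exists L, ulim w a L.
Proof.
move=> wM; pose E r := w (fun n => r <= a n).
have [L [Lub Llub]] : {L | is_lub E L}.
  apply: completeness.
    exists M => r Er; have [n [h]] : exists n, r <= a n /\ Rabs (a n) <= M.
      by apply: ultra_ex; apply: ultra_mono2 Er wM _.
    by have := Rle_abs (a n); lra.
  exists (- M); apply: ultra_mono wM _ => n.
  by have := Rle_abs (- a n); rewrite Rabs_Ropp; lra.
exists L => eps e0.
have [r Er rL] : exists2 r, E r & L - eps < r.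
  apply: NNPP => nr; suff : L <= L - eps by lra.
  apply: Llub => r Er; apply: Rnot_lt_le => rL.
  by apply: nr; exists r.
have nE : w (fun n => ~ L + eps / 2 <= a n).
  case: uw => _ [_ [_ [_ [h _]]]]; case: (h (fun n => L + eps / 2 <= a n)) => // /Lub.
  lra.
by apply: ultra_mono2 Er nE _ => n h1 h2; apply: Rabs_def1; lra.
Qed.

Variables (G : graph) (P : word G -> Prop) (S : seq (word G)) (X Y : word G -> Z).
Variables (sc : nat -> R) (e : nat -> word G).
Hypothesis sc_gt0 : forall n, 0 < sc n.
Hypothesis sc_inf : forall M, w (fun n => M < sc n).
Hypothesis Pe : forall n, P (e n).
Hypothesis dist_XY : forall x y, P x -> P y ->
  INR (wdist S x y) = Rabs (IZR (X x - X y)) + Rabs (IZR (Y x - Y y)).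
Hypothesis surj_XY : forall i j, exists x, [/\ P x, X x = i & Y x = j].
Implicit Types (x y p : nat -> word G).

Definition rescaled (Z : word G -> Z) x (n : nat) : R := IZR (Z (x n) - Z (e n)) / sc n.

(** Places the sequence [x] at the point [(r, s)] of the plane; the lemmas below identify the cone
    with the plane in the l1 metric. *)
Definition coords x (r s : R) : Prop :=
  [/\ forall n, P (x n), ulim w (rescaled X x) r & ulim w (rescaled Y x) s].

Lemma dist_rescaled x y n : P (x n) -> P (y n) ->
  INR (wdist S (x n) (y n)) / sc n =
  Rabs (rescaled X x n - rescaled X y n) + Rabs (rescaled Y x n - rescaled Y y n).
Proof.
move=> Px Py; rewrite dist_XY // /rescaled -!Rdiv_minus_distr -!minus_IZR.
rewrite /Rdiv !Rabs_mult !(Rabs_pos_eq (/ sc n)).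
  by rewrite Rmult_plus_distr_r; do 4?f_equal; lia.
by apply/Rlt_le/Rinv_0_lt_compat.
Qed.

Lemma coords_cdist x y r s r' s' : coords x r s -> coords y r' s' ->
  cdist S w sc x y (Rabs (r - r') + Rabs (s - s')).
Proof.
case=> Px xr xs [Py yr ys] eps e0.
(* Four coordinate sequences converge, and each may use a quarter of [eps]. *)
have e4 : 0 < eps / 4 by lra.
apply: ultra_mono2 (ultra_mono2 (xr _ e4) (xs _ e4) (fun n => @conj _ _))
  (ultra_mono2 (yr _ e4) (ys _ e4) (fun n => @conj _ _)) _ => n [h1 h2] [h3 h4].
rewrite dist_rescaled //.
have tri (a b c d : R) : Rabs (a - c) < eps / 4 -> Rabs (b - d) < eps / 4 ->
    Rabs (Rabs (a - b) - Rabs (c - d)) < eps / 2.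
  move=> ac bd; apply: Rle_lt_trans (Rabs_triang_inv2 _ _) _.
  have -> : a - b - (c - d) = (a - c) + - (b - d) by ring.
  by apply: Rle_lt_trans (Rabs_triang _ _) _; rewrite Rabs_Ropp; lra.
have := tri _ _ _ _ h1 h3; have := tri _ _ _ _ h2 h4.
move=> /Rabs_def2 ? /Rabs_def2 ?; apply: Rabs_def1; lra.
Qed.

Lemma cone_point_coords x : cone_point P S w sc e x -> exists r s, coords x r s.
Proof.
case=> Px [M xM].
have ee Z n : rescaled Z e n = 0 by rewrite /rescaled Z.sub_diag /Rdiv Rmult_0_l.
have [|r xr] := @ulim_bounded (rescaled X x) M.
  apply: ultra_mono xM _ => n; rewrite dist_rescaled // !ee !Rminus_0_r.
  by have := Rabs_pos (rescaled Y x n); lra.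
have [|s xs] := @ulim_bounded (rescaled Y x) M.
  apply: ultra_mono xM _ => n; rewrite dist_rescaled // !ee !Rminus_0_r.
  by have := Rabs_pos (rescaled X x n); lra.
by exists r, s.
Qed.

Lemma coords_cone_point x r s : coords x r s -> cone_point P S w sc e x.
Proof.
move=> xrs; have ee : coords e 0 0.
  by split=> // eps e0; apply: ultra_mono (sc_inf 0) _ => n _;
    rewrite /rescaled Z.sub_diag /Rdiv Rmult_0_l Rminus_0_r Rabs_R0.
case: (xrs) => Px _ _; split=> //.
have := coords_cdist xrs ee; set L := _ + _ => /(_ 1 Rlt_0_1) xe.
by exists (L + 1); apply: ultra_mono xe _ => n /Rabs_def2; lra.
Qed.

(** Rounding [r * sc n] and [s * sc n] up to integers costs at most [1 / sc n] after rescaling,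
    which tends to 0 along [w]. *)
Lemma coords_surj r s : exists x, coords x r s.
Proof.
pose Q n z := [/\ P z, X z = (X (e n) + up (r * sc n))%Z &
  Y z = (Y (e n) + up (s * sc n))%Z].
pose x n := epsilon (inhabits ([::] : word G)) (Q n).
have xQ n : Q n (x n) by apply: epsilon_spec; apply: surj_XY.
have lim (Z : word G -> Z) q : (forall n, Z (x n) = (Z (e n) + up (q * sc n))%Z) ->
    ulim w (rescaled Z x) q.
  move=> xZ eps e0; apply: ultra_mono (sc_inf (/ eps)) _ => n scn.
  have [u1 u2] := archimed (q * sc n); have s0 := sc_gt0 n.
  have -> : rescaled Z x n - q = (IZR (up (q * sc n)) - q * sc n) / sc n.
    rewrite /rescaled xZ.
    have -> : (Z (e n) + up (q * sc n) - Z (e n) = up (q * sc n))%Z by lia.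
    by field; lra.
  rewrite Rabs_pos_eq; last by apply: Rle_mult_inv_pos; lra.
  apply: (Rle_lt_trans _ (1 / sc n)).
    by apply: Rmult_le_compat_r; [apply/Rlt_le/Rinv_0_lt_compat|lra].
  rewrite /Rdiv Rmult_1_l -(Rinv_inv eps); apply: Rinv_lt_contravar => //.
  by apply: Rmult_lt_0_compat => //; apply: Rinv_0_lt_compat.
by exists x; split=> [n||]; [|apply: lim => n|apply: lim => n]; case: (xQ n).
Qed.

Section PlanePath.
Variables u1 u2 v1 v2 : R.

(* The segment from [u] to [v] pushed sideways along the vector orthogonal to [u],
   to the side of [v], so that it misses the origin. *)
Let m := if Rle_dec 0 (u1 * v2 - u2 * v1) then 1 else - 1.
Definition bent1 t := (1 - t) * u1 + t * v1 - m * (t * (1 - t)) * u2.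
Definition bent2 t := (1 - t) * u2 + t * v2 + m * (t * (1 - t)) * u1.

Lemma bent_neq0 t : 0 <= t <= 1 -> u1 <> 0 \/ u2 <> 0 -> v1 <> 0 \/ v2 <> 0 ->
  0 < Rabs (bent1 t) + Rabs (bent2 t).
Proof.
move=> t01 u0 v0.
suff nz : ~ (bent1 t = 0 /\ bent2 t = 0).
  have := Rabs_pos (bent1 t); have := Rabs_pos (bent2 t).
  case: (Req_dec (bent1 t) 0) => [b1|/Rabs_pos_lt]; last lra.
  case: (Req_dec (bent2 t) 0) => [b2|/Rabs_pos_lt]; last lra.
  by case: nz.
case: (Req_dec t 0) => [->|t0]; first by rewrite /bent1 /bent2 => -[]; lra.
case: (Req_dec t 1) => [->|t1]; first by rewrite /bent1 /bent2 => -[]; lra.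
case=> b1 b2.
(* This is the cross product of [u] with the bent point. By the choice of [m] the two summands do
   not have opposite signs, and the second is nonzero. *)
have : t * ((u1 * v2 - u2 * v1) + m * ((1 - t) * (u1 * u1 + u2 * u2))) = 0.
  have -> : t * ((u1 * v2 - u2 * v1) + m * ((1 - t) * (u1 * u1 + u2 * u2))) =
    u1 * bent2 t - u2 * bent1 t by rewrite /bent1 /bent2; ring.
  by rewrite b1 b2; ring.
case/Rmult_integral => //.
have q0 : 0 < u1 * u1 + u2 * u2.
  by have := Rle_0_sqr u1; have := Rle_0_sqr u2;
    case: u0 => /Rsqr_pos_lt; rewrite /Rsqr; lra.
have : 0 < (1 - t) * (u1 * u1 + u2 * u2) by apply: Rmult_lt_0_compat; lra.
set q := _ * (_ + _); rewrite /m => q1; case: Rle_dec => d0 /=; first lra.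
by have := Rnot_le_lt _ _ d0; lra.
Qed.

(** Differences of the quadratic term factor as [(t - t') * (1 - t - t')], and the second factor is
    at most 1 in absolute value. *)
Lemma bent_lipschitz : exists2 K, 0 < K & forall t t', 0 <= t <= 1 -> 0 <= t' <= 1 ->
  Rabs (bent1 t - bent1 t') + Rabs (bent2 t - bent2 t') <= K * Rabs (t - t').
Proof.
exists (Rabs (v1 - u1) + Rabs (v2 - u2) + Rabs u1 + Rabs u2 + 1).
  have := Rabs_pos (v1 - u1); have := Rabs_pos (v2 - u2).
  have := Rabs_pos u1; have := Rabs_pos u2; lra.
move=> t t' t01 t01'.
have -> : bent1 t - bent1 t' = ((v1 - u1) + - (m * (1 - t - t')) * u2) * (t - t').
  by rewrite /bent1; ring.
have -> : bent2 t - bent2 t' = ((v2 - u2) + m * (1 - t - t') * u1) * (t - t').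
  by rewrite /bent2; ring.
rewrite !Rabs_mult -Rmult_plus_distr_r; apply: Rmult_le_compat_r; first exact: Rabs_pos.
have m1 : Rabs (m * (1 - t - t')) <= 1.
  by rewrite /m; case: Rle_dec => ? /=; apply: Rabs_le; lra.
have h1 := Rabs_triang (v1 - u1) (- (m * (1 - t - t')) * u2).
have h2 := Rabs_triang (v2 - u2) (m * (1 - t - t') * u1).
rewrite Rabs_mult Rabs_Ropp in h1; rewrite Rabs_mult in h2.
have := Rmult_le_compat_r _ _ _ (Rabs_pos u1) m1.
have := Rmult_le_compat_r _ _ _ (Rabs_pos u2) m1.
lra.
Qed.

End PlanePath.

(** With [p] moved to the origin, [x] and [y] become nonzero vectors, and the bent segment joins
    them off the origin. *)
Lemma plane_no_cut_point p : ~ cut_point P S w sc e p.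
Proof.
case=> /cone_point_coords[p1 [p2 pP]] [x [y [/cone_point_coords[x1 [x2 xP]]
  [/cone_point_coords[y1 [y2 yP]] [[L [L0 xL]] [[L' [L'0 yL']] nopath]]]]]].
have u0 : x1 - p1 <> 0 \/ x2 - p2 <> 0.
  apply: NNPP => /not_or_and[/NNPP z1 /NNPP z2].
  by move: L0; rewrite (ulim_unique xL (coords_cdist xP pP)) z1 z2 Rabs_R0; lra.
have v0 : y1 - p1 <> 0 \/ y2 - p2 <> 0.
  apply: NNPP => /not_or_and[/NNPP z1 /NNPP z2].
  by move: L'0; rewrite (ulim_unique yL' (coords_cdist yP pP)) z1 z2 Rabs_R0; lra.
pose F1 := bent1 (x1 - p1) (x2 - p2) (y1 - p1) (y2 - p2).
pose F2 := bent2 (x1 - p1) (x2 - p2) (y1 - p1) (y2 - p2).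
pose Q t z := coords z (p1 + F1 t) (p2 + F2 t).
(* A point of the path is a sequence of words, chosen to have the prescribed plane coordinates. *)
pose f t := epsilon (inhabits p) (Q t).
have fP t : Q t (f t).
  by apply: epsilon_spec; apply: coords_surj.
apply: nopath; exists f; split.
  have := coords_cdist (fP 0) xP.
  have -> : p1 + F1 0 - x1 = 0 by rewrite /F1 /bent1; ring.
  have -> : p2 + F2 0 - x2 = 0 by rewrite /F2 /bent2; ring.
  by rewrite Rabs_R0 Rplus_0_r.
split.
  have := coords_cdist (fP 1) yP.
  have -> : p1 + F1 1 - y1 = 0 by rewrite /F1 /bent1; ring.
  have -> : p2 + F2 1 - y2 = 0 by rewrite /F2 /bent2; ring.
  by rewrite Rabs_R0 Rplus_0_r.
split=> [t t01|t t01 eps e0].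
  split; first exact: coords_cone_point (fP t).
  exists (Rabs (F1 t) + Rabs (F2 t)); split; first exact: bent_neq0.
  have -> : F1 t = p1 + F1 t - p1 by ring.
  have -> : F2 t = p2 + F2 t - p2 by ring.
  exact: coords_cdist (fP t) pP.
have [K K0 lip] := bent_lipschitz (x1 - p1) (x2 - p2) (y1 - p1) (y2 - p2).
exists (eps / K); split; first exact: Rdiv_lt_0_compat.
move=> t' t01' tt'; exists (Rabs (F1 t - F1 t') + Rabs (F2 t - F2 t')); split.
  apply: Rle_lt_trans (lip t t' t01 t01') _.
  have -> : eps = K * (eps / K) by field; lra.
  exact: Rmult_lt_compat_l.
have -> : F1 t - F1 t' = p1 + F1 t - (p1 + F1 t') by ring.
have -> : F2 t - F2 t' = p2 + F2 t - (p2 + F2 t') by ring.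
exact: coords_cdist (fP t) (fP t').
Qed.

End Cones.

(** * The group of the 4-cycle as a product of two infinite dihedral groups *)

Section Square.
Variables (G : graph) (s t s' t' : gV G).
Hypotheses (st : s != t) (st' : s' != t').
Hypotheses (nst : ~~ gadj s t) (nst' : ~~ gadj s' t').
Hypotheses (ss' : gadj s s') (st_ : gadj s t') (ts' : gadj t s') (tt' : gadj t t').
Implicit Types (u w x y g : word G) (A : {set gV G}).

Let neqs : [/\ s != s', s != t', t != s' & t != t'].
Proof.
by split; [move: ss'|move: st_|move: ts'|move: tt'];
  apply: contraTneq => ->; rewrite gadj_irr.
Qed.

(** Each of [s], [t] commutes with each of [s'], [t'], so a new letter either acts on the first
    dihedral factor or moves past it to the second. *)
Lemma square_normal_form w : all (mem [:: s; t; s'; t']) w ->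
  weq w (dihedral s t (foldr (refl s t) 0%Z w) ++
         dihedral s' t' (foldr (refl s' t') 0%Z w)).
Proof.
case: neqs => n1 n2 n3 n4; elim: w => //= r w IH /andP[rA /IH{IH}].
set i := foldr _ _ w; set j := foldr _ _ w => wE.
have push q : gadj q s -> gadj q t ->
    weq (q :: dihedral s t i ++ dihedral s' t' j) (dihedral s t i ++ q :: dihedral s' t' j).
  move=> qs qt; rewrite -cat_cons weq_commute; first by rewrite -catA.
  exact: all_dihedral.
rewrite wE; move: rA; rewrite !inE => /or4P[] /eqP->; rewrite /refl ?eqxx.
- by rewrite (negPf n1) (negPf n2) -cat_cons dihedral_l.
- by rewrite (eq_sym t s) (negPf st) (negPf n3) (negPf n4) -cat_cons dihedral_r.
- rewrite (eq_sym s') (eq_sym s') (negPf n1) (negPf n3) push ?dihedral_l //;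
    by rewrite gadj_sym.
rewrite (eq_sym t' s) (eq_sym t' t) (eq_sym t' s') (negPf n2) (negPf n4) (negPf st').
by rewrite push ?dihedral_r // gadj_sym.
Qed.

(** A letter belongs to at most one of the two pairs and raises the absolute value of that
    coordinate by at most 1. *)
Lemma square_displacement w :
  Z.abs_nat (foldr (refl s t) 0%Z w) + Z.abs_nat (foldr (refl s' t') 0%Z w) <= size w.
Proof.
case: neqs => n1 n2 n3 n4; elim: w => //= r w IH.
have le q q' k : Z.abs_nat (refl q q' r k) <= Z.abs_nat k + ((r == q) || (r == q')).
  by rewrite /refl; case: (r == q); case: (r == q'); rewrite ?orbT ?orbF; lia.
have disj : ((r == s) || (r == t)) + ((r == s') || (r == t')) <= 1.
  case: (r =P s) => [->|_]; first by rewrite (negPf n1) (negPf n2).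
  by case: (r =P t) => [->|_]; rewrite ?(negPf n3) ?(negPf n4) // leq_b1.
apply: leq_trans (leq_add (le _ _ _) (le _ _ _)) _.
by rewrite addnACA (leq_trans (leq_add IH disj)) ?addn1.
Qed.

Lemma square_wide A g : A =i [:: s; t; s'; t'] -> wide (psub A g).
Proof.
move=> AE; exists (pgen A g); split; first exact: psub_generates.
pose X x := foldr (refl s t) 0%Z (rev g ++ x ++ g).
pose Y x := foldr (refl s' t') 0%Z (rev g ++ x ++ g).
have coordE q q' x u : ~~ gadj q q' -> weq x (conjw g u) ->
    foldr (refl q q') 0%Z (rev g ++ x ++ g) = foldr (refl q q') 0%Z u.
  by move=> nq xu; apply: refl_foldr; rewrite // xu conjw_revK.
(* [rev u] acts isometrically and takes the image of 0 under [u] back to 0. *)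
have diffE q q' u w : ~~ gadj q q' ->
    Z.abs_nat (foldr (refl q q') 0%Z (rev u ++ w)) =
    Z.abs_nat (foldr (refl q q') 0%Z u - foldr (refl q q') 0%Z w).
  move=> nq; have := refl_foldr_dist q q' (rev u)
    (foldr (refl q q') 0%Z w) (foldr (refl q q') 0%Z u).
  rewrite -!foldr_cat (refl_foldr 0%Z nq (weq_revcat0 u)) /=; lia.
have distE x y : psub A g x -> psub A g y ->
    wdist (pgen A g) x y = Z.abs_nat (X x - X y) + Z.abs_nat (Y x - Y y).
  move=> [u Au xu] [w Aw yw].
  rewrite /X /Y !(coordE _ _ _ _ nst xu) !(coordE _ _ _ _ nst yw).
  rewrite !(coordE _ _ _ _ nst' xu) !(coordE _ _ _ _ nst' yw) -!diffE //.
  (* The normal form bounds the distance from above, the displacement from below. *)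
  apply/eqP; rewrite eqn_leq; apply/andP; split.
    apply/(wdist_leP _ Au Aw xu yw); eexists; split; last first.
    - apply: square_normal_form; rewrite -(eq_all AE) all_cat all_rev Au.
      exact: Aw.
    - by rewrite all_cat !all_dihedral ?AE ?inE ?eqxx ?orbT.
    by rewrite size_cat !size_dihedral.
  have [w' [sw' _ wE]] := (wdist_leP _ Au Aw xu yw).1 (leqnn _).
  apply: leq_trans sw'; rewrite (refl_foldr 0%Z nst wE) (refl_foldr 0%Z nst' wE).
  exact: square_displacement.
move=> w sc e uw sc0 scinf Pe p.
apply: (plane_no_cut_point uw (X := X) (Y := Y)) => // [x y Px Py|i j].
  rewrite distE // plus_INR !INR_IZR_INZ !Zabs2Nat.id_abs !abs_IZR //.
exists (conjw g (dihedral s t i ++ dihedral s' t' j)).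
have skip (q q' r r' : gV G) n m : r != q -> r != q' -> r' != q -> r' != q' ->
    foldr (refl q q') n (dihedral r r' m) = n.
  move=> rq rq' rq1 rq1'; have : all (fun v => (v != q) && (v != q')) (dihedral r r' m).
    by apply: all_dihedral; rewrite ?rq ?rq1.
  elim: (dihedral r r' m) => //= v k IH /andP[/andP[/negPf vq /negPf vq'] /IH->].
  by rewrite /refl vq vq'.
case: neqs => n1 n2 n3 n4; split.
- eexists; last reflexivity.
  by rewrite all_cat !all_dihedral ?AE ?inE ?eqxx ?orbT.
- rewrite /X (coordE _ _ _ _ nst (weq_refl _)) foldr_cat (skip s t s' t') ?refl_dihedral //;
    by rewrite eq_sym.
rewrite /Y (coordE _ _ _ _ nst' (weq_refl _)) foldr_cat (skip s' t' s t) // refl_dihedral //.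
Qed.

End Square.

(** * Thick graphs *)

Lemma induced_iso_comp (G0 G G' : graph) (V : {set gV G}) (f : gV G -> gV G') :
    injective f -> (forall x y, gadj x y = gadj (f x) (f y)) ->
  induced_iso G G0 V -> induced_iso G' G0 (f @: V).
Proof.
move=> f_inj fE [h [h_inj [hV [Vh hE]]]]; exists (f \o h).
split; first exact: inj_comp.
split=> [x|]; first exact: imset_f.
split=> [_ /imsetP[a /Vh[x <-] ->]|x y]; first by exists x.
by rewrite /= hE fE.
Qed.

Lemma not_clique_imset (G G' : graph) (V : {set gV G}) (f : gV G -> gV G') :
    injective f -> (forall x y, gadj x y = gadj (f x) (f y)) ->
  not_clique V -> not_clique (f @: V).
Proof.
move=> f_inj fE [x [y [Vx Vy xy nxy]]]; exists (f x), (f y).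
by split; rewrite ?imset_f ?(inj_eq f_inj) // -fE.
Qed.

Lemma K22_wide (G : graph) (A : {set gV G}) g : induced_iso G K22 A -> wide (psub A g).
Proof.
case=> f [f_inj [fA [Af fE]]]; pose i k := f (@inord 3 k).
have adj j k : j < 4 -> k < 4 -> gadj (i j) (i k) = odd (j + k).
  by move=> j4 k4; rewrite -fE /= /c4_adj !inordK.
have neq j k : j < 4 -> k < 4 -> j != k -> i j != i k.
  by move=> j4 k4; apply: contraNneq => /f_inj/(congr1 val) /=; rewrite !inordK // => ->.
(* Indices of equal parity are opposite corners, and each opposite pair generates one dihedral
   factor. *)
apply: (@square_wide _ (i 0) (i 2) (i 1) (i 3)); rewrite ?adj ?neq // => x.
apply/idP/idP=> [/Af[k <-]|].
  have -> : f k = i k by rewrite /i inord_val.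
  by case: k => -[|[|[|[|//]]]] /= _; rewrite !inE eqxx ?orbT.
by rewrite !inE => /or4P[] /eqP->; apply: fA.
Qed.

(** Since [n] is chosen before [g], the cone case gets one order for both the base subgroup and its
    conjugate by the apex. *)
Lemma thick_graph_psub (G : graph) : thick_graph G ->
  exists n, forall (G' : graph) (A : {set gV G'}) (g : word G'),
    induced_iso G' G A -> thick n (psub A g).
Proof.
elim=> {G} [G isoG|G0 G v _ [n IH] isoG ncl|
            G1 G2 G V1 V2 _ [n1 IH1] _ [n2 IH2] V12 iso1 iso2 ncl].
- exists 0 => G' A g [f [f_inj [fA [Af fE]]]]; apply: K22_wide.
  have <- : f @: [set: gV G] = A.
    apply/setP=> a; apply/imsetP/idP=> [[x _ ->]//|/Af[x <-]]; by exists x.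
  exact: induced_iso_comp isoG.
- exists n.+1 => G' A g [f [f_inj [fA [Af fE]]]].
  have Av : f @: [set~ v] = A :\ f v.
    apply/setP=> a; rewrite !inE; apply/imsetP/andP=> [[x xv ->]|[av /Af[x xa]]].
      by rewrite !inE in xv; rewrite (inj_eq f_inj).
    by subst a; exists x; rewrite // !inE -(inj_eq f_inj).
  have iso0 : induced_iso G' G0 (A :\ f v) by rewrite -Av; apply: induced_iso_comp isoG.
  pose D := [set s in A | gadj (f v) s].
  have DE : f @: [set x | (x != v) && gadj v x] = D.
    apply/setP=> a; rewrite !inE; apply/imsetP/andP=> [[x + ->]|[/Af[x <-]]].
      by rewrite inE fE => /andP[].
    rewrite -fE => vx; exists x => //; rewrite inE vx andbT.
    by apply: contraTneq vx => ->; rewrite gadj_irr.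
  (* Both subgroups come from the base of the cone, the second conjugated by the apex [f v]; they
     meet in the link [D]. *)
  apply: (@thick_two _ n A (A :\ f v) (A :\ f v) D g [:: f v]) => //=.
  + by rewrite fA.
  + exact: subD1set.
  + exact: subD1set.
  + by apply/subsetP=> s; rewrite inE => /andP[].
  + exact: IH.
  + exact: IH.
  + exact: psub_cap_conj.
  + by apply: psub_infinite; rewrite -DE; apply: not_clique_imset.
  exact: finite_index_cone.
(* The two pieces may have different orders, so both are raised to the maximum. *)
exists (maxn n1 n2).+1 => G' A g [f [f_inj [fA [Af fE]]]].
have sub (V : {set gV G}) : f @: V \subset A by apply/subsetP=> _ /imsetP[x _ ->].
apply: (@thick_two _ _ A (f @: V1) (f @: V2) (f @: (V1 :&: V2)) g [::]);
  rewrite ?cats0 ?sub //.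
- by apply: thick_leq (leq_maxl _ _) _; apply: IH1; apply: induced_iso_comp iso1.
- by apply: thick_leq (leq_maxr _ _) _; apply: IH2; apply: induced_iso_comp iso2.
- by rewrite psub_cap imsetI // => x y _ _; apply: f_inj.
- by apply: psub_infinite; apply: not_clique_imset.
apply: finite_index_union; rewrite -imsetU V12.
by apply/setP=> a; apply/imsetP/idP=> [[x _ ->]//|/Af[x <-]]; exists x.
Qed.

Unset Implicit Arguments.

Theorem theorem2p2 (G : graph) : thick_graph G -> strongly_thick (@W_all G).
Proof.
move=> /thick_graph_psub[n thG]; exists n.
(* The whole group is the special subgroup on all vertices with empty conjugator. *)
have <- : psub [set: gV G] [::] = @W_all G.
  apply: functional_extensionality => x; apply: propositional_extensionality.
  split=> // _; exists x; last by rewrite /conjw /= cats0.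
  by apply/allP=> s _; rewrite inE.
apply: thG; exists id; split=> //; split=> [x|]; first by rewrite inE.
by split=> // a _; exists a.
Qed.
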